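(* Let $D\in\mathbb{N}$, let $U=\mathcal{T}_D$, let $L$ be a relative involutive division on $U$, and let $G$ be a generalized Ufnarovsky-like graph of $L$. (a) Let $M\subseteq U$ and let $J=(M)$ be the semigroup ideal generated by $M$. Then $J=\bigcup_{l\in M}C_L(l,U)$ if and only if $M$ is $G$-compliant. (b) Let $N\subseteq U$. Then $H:=\bigl(\bigcup_{l\in N}C_L(l,U)\bigr)\cup\{v\in\mathcal{T}:\deg(v)<D\}$ is an order ideal if and only if $N$ is $G$-revenant.
   Context: $\mathcal{T}$ is the set (monoid) of all terms (monic monomials) $x_1^{\gamma_1}\cdots x_n^{\gamma_n}$ in the variables $x_1,\dots,x_n$, and $\mathcal{T}_D$ is the set of terms of degree $D$. The semigroup ideal generated by a set $M$ of terms is $(M)=\{\tau m:\tau\in\mathcal{T},m\in M\}$. A subset of $\mathcal{T}$ is an order ideal if it contains every divisor of each of its elements. A relative involutive division $L$ on a finite set $U\subset\mathcal{T}$ is the assignment, to each $u\in U$, of a partition $\{x_1,\dots,x_n\}=M_L(u,U)\sqcup NM_L(u,U)$ of the variables into multiplicative and non-multiplicative ones such that, setting $L(u,U)=\{x_1^{a_1}\cdots x_n^{a_n} : a_i\ne 0\Rightarrow x_i\in M_L(u,U)\}$ and $C_L(u,U)=uL(u,U)=\{uw: w\in L(u,U)\}$ (the cone of $u$): (1) the semigroup ideal generated by $U$ equals $\bigcup_{u\in U}C_L(u,U)$; (2) $C_L(u,U)\cap C_L(v,U)=\emptyset$ for all distinct $u,v\in U$. A generalized Ufnarovsky-like graph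 of $L$ is an oriented graph $G$ with vertex set $U$ such that: (i) every edge $t\to s$ of $G$ satisfies $\operatorname{lcm}(s,t)\in C_L(t,U)$; (ii) whenever $s,t\in U$ satisfy $\operatorname{lcm}(s,t)\in C_L(t,U)$, there is an oriented path (possibly of length $0$ when $s=t$) from $t$ to $s$ in $G$; (iii) there are no redundant edges: for no edge $t\to s$ of $G$ is there an oriented path from $t$ to $s$ in $G$ avoiding that edge. A subset $M\subseteq U$ is $G$-compliant if for all $t,s\in U$ for which there is an oriented path from $t$ to $s$ in $G$, $s\in M$ implies $t\in M$. A subset $N\subseteq U$ is $G$-revenant if for all $t,s\in U$ for which there is an oriented path from $t$ to $s$ in $G$, $t\in N$ implies $s\in N$. *)

(* Defs.v *)
From mathcomp Require Import all_boot all_order.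
From mathcomp Require Import finmap mpoly.
From mathcomp Require Import boolp classical_sets.

Set Implicit Arguments.
Unset Strict Implicit.
Unset Printing Implicit Defensive.

Local Open Scope classical_set_scope.

(** A term x_1^c_1 ... x_n^c_n is its exponent vector in
    ['X_{1..n}]: the product of terms is [(_ + _)%MM], divisibility is
    [(_ <= _)%MM], the lcm is [mlcm], the total degree is [mdeg]. *)

Definition terms_of_degree (n D : nat) : {fset 'X_{1..n}} :=
  [fset bmnm m | m in {: 'X_{1..n < D.+1}} & mdeg m == D]%fset.

Lemma in_terms_of_degree (n D : nat) (m : 'X_{1..n}) :
  (m \in terms_of_degree n D) = (mdeg m == D).
Proof.
apply/imfsetP/eqP => [[b /=]|mD].
  by rewrite !inE => /eqP bD ->.
have lt_mD : mdeg m < D.+1 by rewrite mD.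
by exists (BMultinom lt_mD) => //=; rewrite !inE /= mD eqxx.
Qed.

Definition semigroup_ideal (n : nat) (A : set 'X_{1..n}) : set 'X_{1..n} :=
  [set (t + m)%MM | t in setT & m in A].

Definition order_ideal (n : nat) (A : set 'X_{1..n}) : Prop :=
  forall v w : 'X_{1..n}, A v -> (w <= v)%MM -> A w.

(** [mu] assigns multiplicative variables; the non-multiplicative variables of
    [u] are the complement [~: mu u]. *)
Definition mult_terms (n : nat) (U : {fset 'X_{1..n}}) (mu : U -> {set 'I_n})
    (u : U) : set 'X_{1..n} :=
  [set w : 'X_{1..n} | forall i : 'I_n, w i != 0 -> i \in mu u].

Definition cone_of (n : nat) (U : {fset 'X_{1..n}}) (mu : U -> {set 'I_n})
    (u : U) : set 'X_{1..n} :=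
  [set (val u + w)%MM | w in mult_terms mu u].

Record involutive_division (n : nat) (U : {fset 'X_{1..n}}) :=
  InvolutiveDivision {
    mult_vars : U -> {set 'I_n};
    ideal_cones :
      semigroup_ideal [set` U] = \bigcup_(u in setT) cone_of mult_vars u;
    cones_disjoint : forall u v : U, u <> v ->
      cone_of mult_vars u `&` cone_of mult_vars v = set0
  }.

Definition cone (n : nat) (U : {fset 'X_{1..n}}) (L : involutive_division U)
    (u : U) : set 'X_{1..n} :=
  cone_of (mult_vars L) u.

(** An oriented graph with vertex set [U] is its edge relation [G : rel U];
    [connect G t s] says that there is an oriented path from [t] to [s],
    possibly of length 0. *)
Record ufnarovsky_like (n : nat) (U : {fset 'X_{1..n}})
    (L : involutive_division U) (G : rel U) : Prop := UfnarovskyLike {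
  edge_lcm : forall t s : U, G t s -> cone L t (mlcm (val s) (val t));
  lcm_path : forall s t : U, cone L t (mlcm (val s) (val t)) -> connect G t s;
  no_redundant_edge : forall t s : U, G t s ->
    ~~ connect [rel x y | G x y && ((x, y) != (t, s))] t s
}.

Definition compliant (n : nat) (U : {fset 'X_{1..n}}) (G : rel U)
    (M : set U) : Prop :=
  forall t s : U, connect G t s -> M s -> M t.

Definition revenant (n : nat) (U : {fset 'X_{1..n}}) (G : rel U)
    (N : set U) : Prop :=
  forall t s : U, connect G t s -> N t -> N s.

(* Main.v *)
Require Import Defs.
From mathcomp Require Import all_boot all_order.
From mathcomp Require Import finmap mpoly.
From mathcomp Require Import boolp classical_sets.

Set Implicit Arguments.
Unset Strict Implicit.
Unset Printing Implicit Defensive.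

Local Open Scope classical_set_scope.

(** Every multiple [v] of an element of [U] lies in exactly one cone; call the
    vertex of that cone the involutive divisor of [v].  Two observations link
    the graph to involutive divisors.

    First, a cone contains every term between its vertex [u] and one of its
    elements [v].  So if [u] is the involutive divisor of [v] and [s] is any
    other element of [U] dividing [v], then lcm(s, u) lies in the cone of [u],
    and the graph has a path from [u] to [s] ([connect_of_dvd]).  Compliance
    thus puts in [M] the involutive divisor of any multiple of an element of
    [M], and revenance puts in [N] every divisor in [U] of a term whose
    involutive divisor is in [N]; these are the two backward implications.

    Conversely, compliance and revenance need only be checked along one edge
    [t -> s], where lcm(s, t) has involutive divisor [t].  If the ideal of [M]
    is the union of the cones over [M] and [s] is in [M], then lcm(s, t) is in
    the ideal, hence in a cone over [M], and uniqueness gives [t] in [M].  If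
    [H] is an order ideal and [t] is in [N], then lcm(s, t) is in [H], hence so
    is its divisor [s], whose degree [D] forces it into a cone over [N]; as [s]
    is its own involutive divisor, [s] is in [N].

    The degree enters only in (b): a term of degree at least [D] is a multiple
    of an element of [U] ([exists_dvd_mdeg]), so it has an involutive
    divisor. *)

Lemma exists_dvd_mdeg (n D : nat) (v : 'X_{1..n}) :
  D <= mdeg v -> exists2 m : 'X_{1..n}, (m <= v)%MM & mdeg m = D.
Proof.
elim: D => [|D IHD] leDv.
  by exists 0%MM; [apply/mnm_lepP => i; rewrite mnm0E | apply: mdeg0].
have [m le_mv degm] := IHD (ltnW leDv).
(* v / m has positive degree, so some variable still fits below v *)
have: mdeg (v - m)%MM != 0.
  by apply/eqP => deg0; move: leDv; rewrite -(submK le_mv) mdegD deg0 degm ltnn.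
rewrite mdeg_eq0 => nz.
have [i nz_i] : exists i, (v - m)%MM i != 0.
  apply/existsP; apply: contraNT nz; rewrite negb_exists => /forallP z.
  by apply/eqP/mnmP => i; rewrite mnm0E; apply/eqP; move: (z i); rewrite negbK.
exists (U_(i) + m)%MM; last by rewrite mdegD mdeg1 degm.
apply/mnm_lepP => j; rewrite mnmDE mnm1E.
case: (eqVneq i j) => [<-|_]; last by rewrite add0n; apply/mnm_lepP.
by move: nz_i; rewrite mnmBE subn_eq0 -ltnNge.
Qed.

Section Cones.

Context (n : nat) (U : {fset 'X_{1..n}}) (L : involutive_division U).
Implicit Types (u t s : U) (v w : 'X_{1..n}).

Lemma cone_dvd u v : cone L u v -> (val u <= v)%MM.
Proof. by case=> w _ <-; apply: lem_addr. Qed.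

Lemma cone_vertex u : cone L u (val u).
Proof. by exists 0%MM; rewrite ?addm0 // => i; rewrite mnm0E eqxx. Qed.

Lemma cone_convex u v w :
  cone L u v -> (val u <= w)%MM -> (w <= v)%MM -> cone L u w.
Proof.
case=> a mult_a <- le_uw /mnm_lepP le_wv.
exists (w - val u)%MM; last by rewrite addmC submK.
move=> i; rewrite mnmBE -lt0n subn_gt0 => lt_uw; apply: mult_a.
by rewrite -lt0n -(ltn_add2l (val u i)) addn0 -mnmDE (leq_trans lt_uw).
Qed.

Lemma cone_uniq u s v : cone L u v -> cone L s v -> u = s.
Proof.
move=> uv sv; apply: contrapT => /(cones_disjoint L) disj.
by have: (cone L u `&` cone L s) v by []; rewrite disj.
Qed.

Lemma cone_cover s v : (val s <= v)%MM -> exists u, cone L u v.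
Proof.
move=> le_sv; have : semigroup_ideal [set` U] v.
  by exists (v - val s)%MM => //; exists (val s); rewrite ?submK //; apply: valP.
by rewrite (ideal_cones L) => -[u _ uv]; exists u.
Qed.

Lemma semigroup_ideal_val (M : set U) v :
  semigroup_ideal (val @` M) v <-> exists2 s, M s & (val s <= v)%MM.
Proof.
split=> [[a _ [_ [s Ms <-] <-]]|[s Ms le_sv]].
  by exists s => //; apply: lem_addl.
by exists (v - val s)%MM => //; exists (val s); [exists s | apply: submK].
Qed.

Context {G : rel U} (hG : ufnarovsky_like L G).

(** lcm(s, u) divides [v] as both [s] and [u] do, so it lies between [u] and
    [v], hence in the cone of [u]. *)
Lemma connect_of_dvd u s v : cone L u v -> (val s <= v)%MM -> connect G u s.
Proof.
move=> uv le_sv; apply: (lcm_path hG); apply: (cone_convex uv).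
  exact: lem_mlcmr.
by rewrite lem_mlcm le_sv cone_dvd.
Qed.

Lemma revenant_edge (N : set U) :
  (forall t s, G t s -> N t -> N s) -> revenant G N.
Proof.
move=> step t _ /connectP[p path_p ->].
elim: p t path_p => //= s p IHp t /andP[Gts path_p] Nt.
exact: IHp path_p (step _ _ Gts Nt).
Qed.

(** A set is compliant exactly when its complement is revenant. *)
Lemma compliant_edge (M : set U) :
  (forall t s, G t s -> M s -> M t) -> compliant G M.
Proof.
move=> step t s ts Ms; apply: contrapT => notMt.
suff: (~` M) s by apply.
apply: (@revenant_edge (~` M) _ t s ts notMt) => x y Gxy notMx My.
exact/notMx/(step _ _ Gxy).
Qed.

Lemma semigroup_ideal_eq_cones (M : set U) :
  semigroup_ideal (val @` M) = \bigcup_(l in M) cone L l <-> compliant G M.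
Proof.
split=> [idealE|compM].
  apply: compliant_edge => t s Gts Ms.
  have : semigroup_ideal (val @` M) (mlcm (val s) (val t)).
    by apply/semigroup_ideal_val; exists s; rewrite ?lem_mlcml.
  rewrite idealE => -[l Ml lv].
  by rewrite (cone_uniq (edge_lcm hG Gts) lv).
apply/seteqP; split=> v.
  move=> /semigroup_ideal_val[s Ms le_sv].
  have [u uv] := cone_cover le_sv.
  by exists u => //; apply: compM (connect_of_dvd uv le_sv) Ms.
by case=> l Ml /cone_dvd le_lv; apply/semigroup_ideal_val; exists l.
Qed.

End Cones.

Theorem proposition51 (n D : nat)
    (L : involutive_division (terms_of_degree n D))
    (G : rel (terms_of_degree n D)) (hG : ufnarovsky_like L G) :
  (forall M : set (terms_of_degree n D),
      semigroup_ideal (val @` M) = \bigcup_(l in M) cone L l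
      <-> compliant G M)
  /\
  (forall N : set (terms_of_degree n D),
      order_ideal
        ((\bigcup_(l in N) cone L l) `|` [set v : 'X_{1..n} | (mdeg v < D)%N])
      <-> revenant G N).
Proof.
split=> [M|N]; first exact: semigroup_ideal_eq_cones.
split=> [idealH|revN].
  apply: revenant_edge => t s Gts Nt.
  have deg_s : mdeg (val s) = D.
    by apply/eqP; rewrite -in_terms_of_degree; apply: valP.
  have [||[l Nl ls]|/=] := idealH (mlcm (val s) (val t)) (val s).
  - by left; exists t => //; apply: edge_lcm Gts.
  - exact: lem_mlcml.
  - by rewrite (cone_uniq (cone_vertex L s) ls).
  - by rewrite deg_s ltnn.
move=> v w [[l Nl lv]|/= deg_v] le_wv; last first.
  right => /=; apply: leq_ltn_trans deg_v.
  by rewrite -(submK le_wv) mdegD leq_addl.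
case: (ltnP (mdeg w) D) => [|leDw]; [by right | left].
have [m le_mw deg_m] := exists_dvd_mdeg leDw.
have mU : m \in terms_of_degree n D by rewrite in_terms_of_degree deg_m.
have [u uw] := cone_cover L (s := [` mU]%fset) le_mw.
exists u => //; apply: revN Nl; apply: (connect_of_dvd hG lv).
exact: lepm_trans (cone_dvd uw) le_wv.
Qed.
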